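(* Let $\kappa$ be a regular cardinal and let $G$ be a $\kappa$-existentially closed group of cardinality $\kappa$. Then $|\mathrm{Aut}(G)|=2^{\kappa}$.
   Context: For an infinite cardinal $\kappa$, a group $G$ is called $\kappa$-existentially closed if every system of fewer than $\kappa$ many equations and inequations with coefficients from $G$ which has a solution in some overgroup $H\geq G$ already has a solution in $G$. *)

(* Defs.v *)
From mathcomp Require Import all_boot.
From mathcomp Require Import boolp classical_sets functions cardinality wochoice.

Set Implicit Arguments.
Unset Strict Implicit.
Unset Printing Implicit Defensive.

Local Open Scope classical_set_scope.
Local Open Scope card_scope.

Definition card_lt T U (A : set T) (B : set U) : Prop :=
  A #<= B /\ ~ (B #<= A).
Notation "A '#<' B" := (card_lt A B) (at level 79) : card_scope.

(** There is no type of cardinals: a cardinal kappa is given by a type [K] with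
    |K| = kappa.  An initial order identifies [K] with kappa as an initial
    ordinal; [R] is the non-strict order. *)
Definition initial_order (K : Type) (R : rel K) : Prop :=
  well_order R /\ forall x, [set y | R y x /\ y <> x] #< [set: K].

Definition cofinal (K : Type) (R : rel K) (C : set K) : Prop :=
  forall x, exists2 y, C y & R x y.

(** kappa is infinite and equal to its own cofinality: every cofinal subset of
    the initial ordinal kappa has cardinality kappa. *)
Definition regular_cardinal (K : Type) : Prop :=
  infinite_set [set: K] /\
  exists2 R : rel K, initial_order R &
    forall C : set K, cofinal R C -> C #= [set: K].

Section GroupSystems.
Local Open Scope group_scope.

(** Group words in the variables [X] with coefficients from [G]. *)
Inductive group_term (G X : Type) : Type :=
| Var of X
| Coef of G
| Mul of group_term G X & group_term G X
| Inv of group_term G X.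

Inductive group_literal (G X : Type) : Type :=
| Equation of group_term G X & group_term G X
| Inequation of group_term G X & group_term G X.

Fixpoint term_eval (G X : Type) (H : groupType) (i : G -> H) (v : X -> H)
    (t : group_term G X) : H :=
  match t with
  | Var x => v x
  | Coef g => i g
  | Mul t1 t2 => term_eval i v t1 * term_eval i v t2
  | Inv t1 => (term_eval i v t1)^-1
  end.

Definition literal_holds (G X : Type) (H : groupType) (i : G -> H) (v : X -> H)
    (l : group_literal G X) : Prop :=
  match l with
  | Equation s t => term_eval i v s = term_eval i v t
  | Inequation s t => term_eval i v s <> term_eval i v t
  end.

Definition solves (G X : Type) (H : groupType) (i : G -> H) (v : X -> H)
    (S : set (group_literal G X)) : Prop :=
  forall l, S l -> literal_holds i v l.

(** An overgroup of [G] is a group [H] with an injective homomorphism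
    [i : G -> H].  The type [X] of variables is arbitrary: fewer than kappa
    literals involve fewer than kappa variables, and a variable that does not
    occur in the system can take any value. *)
Definition existentially_closed (K : Type) (G : groupType) : Prop :=
  forall (X : Type) (S : set (group_literal G X)),
    S #< [set: K] ->
    (exists (H : groupType) (i : {multiplicative G -> H}),
       injective i /\ exists v : X -> H, solves i v S) ->
    exists v : X -> G, solves idfun v S.

Definition Aut (G : groupType) : set (G -> G) :=
  [set f | {morph f : x y / x * y} /\ bijective f].

End GroupSystems.

Arguments Aut G : clear implicits.

(* Main.v *)
From HB Require Import structures.
Require Import Defs.
From mathcomp Require Import all_boot.
From mathcomp Require Import boolp classical_sets functions cardinality wochoice.
From mathcomp Require Import filter generic_quotient perm.

(** Enumerate G as (e_k) for k < kappa.  For every branch b : kappa -> 2 choose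
    t_k in G by transfinite recursion so that conjugation by t_k agrees with
    conjugation by t_j, for all j < k, on e_j, on the preimage of e_j under
    conjugation by t_j, and on a witness y_j.  The limit of these conjugations
    is an automorphism.

    A t_k exists because, modulo the filter of final segments of k, the sequence
    (t_j)_{j < k} itself solves the required system of conjugation equations in
    a reduced power of G; there are fewer than kappa equations, so they can be
    solved in G.  The tree splits at every stage: in G x Sym(3) the parameters
    used so far have a common centralizer containing a noncentral element, hence
    so they do in G, by some c moving some y; take y_k = y and let b(k) choose
    between t_k and c t_k.  For the upper bound, kappa^kappa = 2^kappa. *)

Set Implicit Arguments.
Unset Strict Implicit.
Unset Printing Implicit Defensive.

Local Open Scope classical_set_scope.
Local Open Scope card_scope.

(** * Cardinals *)

(** Relations spare the subtypes hidden in [#<=]. [W] may be multivalued: choice selects one image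
    for each point, and left uniqueness makes the selection injective. *)
Lemma card_le_relP T U (A : set T) (B : set U) :
  A #<= B <-> exists W : T -> U -> Prop,
    (forall a, A a -> exists2 b, B b & W a b) /\
    (forall a a' b, W a b -> W a' b -> a = a').
Proof.
split=> [|[W [Wtot Winj]]].
  move=> /card_leP[f].
  exists (fun a b => exists a' : A, a = val a' /\ b = val (f a')).
  split=> [a Aa|a a' b [x [-> ->]] [y [-> xy]]].
    exists (val (f (SigSub (mem_set Aa)))); last by exists (SigSub (mem_set Aa)).
    exact/set_mem/valP.
  by congr val; apply: (@inj _ _ _ f); rewrite ?inE //; exact: val_inj.
have /choice[f fP] : forall a : A, exists b : B, W (val a) (val b).
  move=> a; have [b Bb Wab] := Wtot _ (set_mem (valP a)).
  by exists (SigSub (mem_set Bb)).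
have finj : injective f.
  by move=> x y fxy; apply: val_inj; apply: Winj (fP x) _; rewrite fxy.
apply/card_leP/injfunPex; exists f => //.
by move=> x y _ _; exact: finj.
Qed.

(** Zorn's lemma gives a maximal partial injection between [A] and [B]. It exhausts one of the two
    sets, since otherwise an unmatched pair could be added. *)
Lemma card_le_total T U (A : set T) (B : set U) : A #<= B \/ B #<= A.
Proof.
pose P (W : set (T * U)) := (forall a b, W (a, b) -> A a /\ B b) /\
  ((forall a a' b, W (a, b) -> W (a', b) -> a = a') /\
   (forall a b b', W (a, b) -> W (a, b') -> b = b')).
have [F FP Ftot|M [[MAB [Ml Mr]] Mmax]] := @Zorn_bigcup _ P.
  have Fcomb x y : (\bigcup_(X in F) X) x -> (\bigcup_(X in F) X) y ->
      exists X, [/\ F X, X x & X y].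
    move=> [X FX Xx] [Y FY Yy]; have [XY|YX] := Ftot _ _ FX FY.
      by exists Y; split=> //; exact: XY.
    by exists X; split=> //; exact: YX.
  split=> [a b [X /FP[+ _]]|]; first by apply.
  split=> [a a' b|a b b'] => /Fcomb/[apply] -[X [/FP[_ [Xl Xr]] Xx Xy]].
    exact: Xl Xx Xy.
  exact: Xr Xx Xy.
have [Atot|/existsNP[a /not_implyP[Aa aM]]] :=
    pselect (forall a, A a -> exists b, M (a, b)).
  left; apply/card_le_relP; exists (fun a b => M (a, b)); split=> // a Aa.
  by have [b Mab] := Atot _ Aa; exists b => //; case: (MAB _ _ Mab).
have [Btot|/existsNP[b /not_implyP[Bb bM]]] :=
    pselect (forall b, B b -> exists a, M (a, b)).
  right; apply/card_le_relP; exists (fun b a => M (a, b)).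
  split=> [b Bb|b b' c Mab Mab']; last exact: Mr Mab Mab'.
  by have [c Mab] := Btot _ Bb; exists c => //; case: (MAB _ _ Mab).
case: (Mmax (M `|` [set (a, b)])).
  by split=> [|MM]; [exact: subsetUl|apply: aM; exists b; apply: MM; right].
split=> [x y [/MAB //|[-> ->]]|] //.
split=> [x y z [] Mx [] My|x y z [] Mx [] My].
- exact: Ml Mx My.
- by case: My Mx => -> -> Mx; case: bM; exists x.
- by case: Mx My => -> -> My; case: bM; exists y.
- by case: Mx My => -> -> [->].
- exact: Mr Mx My.
- by case: My Mx => -> -> Mx; case: aM; exists y.
- by case: Mx My => -> -> My; case: aM; exists z.
- by case: Mx My => -> -> [->].
Qed.

(** [Zorn_bigcup] also asks for the union of the empty chain. Admitting [set0] as an extra member of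
    the family handles that chain, and a nonempty [W0] keeps [set0] from being maximal. *)
Lemma Zorn_bigcup_above T (P : set (set T)) (W0 : set T) :
    P W0 ->
    (forall F : set (set T), F !=set0 -> F `<=` P -> total_on F subset ->
      P (\bigcup_(X in F) X)) ->
  exists M, [/\ P M, W0 `<=` M & forall B, M `<` B -> ~ P B].
Proof.
move=> PW0 Pchain; pose P' (B : set T) := B = set0 \/ W0 `<=` B /\ P B.
have [F FP Ftot|M [P'M Mmax]] := @Zorn_bigcup _ P'.
  have [F0|/existsNP[X /not_implyP[FX X0]]] := pselect (forall X, F X -> X = set0).
    by left; apply/seteqP; split=> // x [X /F0->].
  right; split.
    case: (FP _ FX) => [//|[W0X _]]; exact: subset_trans (bigcup_sup FX).
  have -> : \bigcup_(Y in F) Y = \bigcup_(Y in F `&` [set Y | Y <> set0]) Y.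
    apply/seteqP; split=> x [Y FY Yx]; exists Y => //; last by case: FY.
    by split=> // Y0; rewrite Y0 in Yx.
  apply: Pchain => [|Y [/FP[//|[]//]]|Y Z [FY _] [FZ _]]; first by exists X.
  exact: Ftot.
case: P'M => [M0|[W0M PM]].
  have [W00|W0n] := pselect (W0 = set0).
    exists M; rewrite W00 in PW0 *; split; rewrite ?M0 // => B MB PB.
    by apply: (Mmax B); rewrite ?M0 //; right; rewrite W00; split.
  case: (Mmax W0); last by right; split=> [x|].
  by rewrite M0; split; [exact: sub0set|rewrite subset0].
exists M; split=> // B MB PB; apply: (Mmax _ MB); right; split=> //.
by apply: subset_trans W0M _; exact: properW.
Qed.

(** Hessenberg's theorem, by Zorn's lemma on injective pairings D x D -> D with D contained in [A].
    A maximal D absorbs its complement in [A], or else the pairing could be extended. *)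
Lemma card_setX_infinite T (A : set T) : infinite_set A -> A `*` A #<= A.
Proof.
move=> /infiniteP/card_le_relP[W [Wtot Winj]].
have [i [iA i_inj]] : exists i : nat -> T, (forall n, A (i n)) /\ injective i.
  have /choice[i iP] : forall n, exists x, A x /\ W n x.
    by move=> n; have [x] := Wtot n I; exists x.
  exists i; split=> [n|m n imn]; first by case: (iP n).
  have [_ Wm] := iP m; have [_ Wn] := iP n.
  by apply: Winj Wm _; rewrite imn.
(* A set of triples stands for the graph of a pairing; its carrier is read off the diagonal. *)
pose dom (B : set (T * T * T)) x := exists z, B (x, x, z).
pose P (B : set (T * T * T)) :=
  [/\ forall x y, dom B x -> dom B y -> exists z, B (x, y, z),
      forall x y z, B (x, y, z) -> [/\ dom B x, dom B y & dom B z],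
      forall x, dom B x -> A x &
      forall p q z, B (p, z) -> B (q, z) -> p = q].
(* The starting pairing lives on a countable part of [A], where [pickle] codes pairs. It puts the
   distinct points [i 0] and [i 1] into the maximal carrier. *)
pose B0 : set (T * T * T) :=
  [set w | exists m n, w = (i m, i n, i (pickle (m, n)))].
have domB0 n : dom B0 (i n) by exists (i (pickle (n, n))), n, n.
have PB0 : P B0.
  split=> [x y [z [m [n [-> _ _]]]] [z' [m' [n' [-> _ _]]]]
          |x y z [m [n [-> -> ->]]]||].
  - by exists (i (pickle (m, m'))), m, m'.
  - by split; exact: domB0.
  - by move=> x [z [m [n [-> _ _]]]].
  move=> p q z [m [n [-> ->]]] [m' [n' [-> /i_inj]]].
  by move=> /(pcan_inj pickleK)[-> ->].
have [F [X0 FX0] FP Ftot|M [[Mtot Msub MA Minj] B0M Mmax]] := Zorn_bigcup_above PB0.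
  have Fcomb x y : (\bigcup_(X in F) X) x -> (\bigcup_(X in F) X) y ->
      exists X, [/\ F X, X x & X y].
    move=> [X FX Xx] [Y FY Yy]; have [XY|YX] := Ftot _ _ FX FY.
      by exists Y; split=> //; exact: XY.
    by exists X; split=> //; exact: YX.
  have domS X x : F X -> dom X x -> dom (\bigcup_(Y in F) Y) x.
    by move=> FX [z Xz]; exists z, X.
  split=> [x y [z xz] [z' yz]|x y z [X FX Xxyz]|x [z [X FX Xxz]]|p q z].
  - have [X [FX Xx Xy]] := Fcomb _ _ xz yz; have [Xtot _ _ _] := FP _ FX.
    have [||w Xw] := Xtot x y; [by exists z|by exists z'|].
    by exists w, X.
  - have [_ /(_ _ _ _ Xxyz)[xX yX zX] _ _] := FP _ FX.
    by split; exact: domS FX _.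
  - by have [_ _ XA _] := FP _ FX; apply: XA; exists z.
  - move=> /Fcomb/[apply] -[X [/FP[_ _ _ Xinj] Xp Xq]]; exact: Xinj Xp Xq.
have domi n : dom M (i n) by exists (i (pickle (n, n))); apply: B0M; exists n, n.
have [m mP] : exists m : T -> T -> T,
    forall x y, dom M x -> dom M y -> M (x, y, m x y).
  have /choice[m mP] : forall p, exists z, dom M p.1 -> dom M p.2 -> M (p, z).
    move=> [x y] /=; have [xM|xM] := pselect (dom M x); last by exists x.
    have [yM|yM] := pselect (dom M y); last by exists x.
    by have [z] := Mtot _ _ xM yM; exists z.
  by exists (fun x y => m (x, y)) => x y xM yM; exact: mP.
have mM x y : dom M x -> dom M y -> dom M (m x y).
  by move=> xM yM; have [] := Msub _ _ _ (mP _ _ xM yM).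
have m_inj x y x' y' : dom M x -> dom M y -> dom M x' -> dom M y' ->
    m x y = m x' y' -> x = x' /\ y = y'.
  move=> xM yM x'M y'M e; have := mP _ _ x'M y'M; rewrite -e.
  by move=> /(Minj _ _ _ (mP _ _ xM yM))[].
have i01 : i 0 <> i 1 by move=> /i_inj.
(* Pairing with [i 0] or [i 1] embeds two copies of [dom M] in [dom M]. *)
have code (Y : set T) : Y #<= dom M -> exists h : T -> T,
    (forall x, dom M x \/ Y x -> dom M (h x)) /\
    (forall x y, dom M x \/ Y x -> dom M y \/ Y y -> h x = h y -> x = y).
  move=> /card_le_relP[V [Vtot Vinj]].
  have /choice[g gP] : forall x, exists z, Y x -> dom M z /\ V x z.
    move=> x; have [Yx|nYx] := pselect (Y x); last by exists x.
    by have [z zM Vxz] := Vtot _ Yx; exists z.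
  exists (fun x => if `[< dom M x >] then m x (i 0) else m (g x) (i 1)).
  split=> [x|x y].
    case: asboolP => [xM _|xM [//|Yx]]; apply: mM => //.
    by case: (gP x Yx).
  case: asboolP => [xM _|xM [//|Yx]]; case: asboolP => [yM _|yM [//|Yy]].
  - by move=> /(m_inj _ _ _ _ xM (domi 0) yM (domi 0))[].
  - have [gy _] := gP _ Yy.
    by move=> /(m_inj _ _ _ _ xM (domi 0) gy (domi 1))[_ /i01].
  - have [gx _] := gP _ Yx.
    by move=> /(m_inj _ _ _ _ gx (domi 1) yM (domi 0))[_ /esym/i01].
  have [gx Vx] := gP _ Yx; have [gy Vy] := gP _ Yy.
  move=> /(m_inj _ _ _ _ gx (domi 1) gy (domi 1))[e _].
  by apply: (Vinj x y (g x)) => //; rewrite e.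
(* If the complement embeds in the carrier, then so does all of [A], and [m] codes the pairs. *)
have [AM|] := card_le_total (A `\` dom M) (dom M).
  have [h [hM h_inj]] := code _ AM.
  have inM x : A x -> dom M x \/ (A `\` dom M) x.
    by move=> Ax; have [xM|xM] := pselect (dom M x); [left|right].
  apply/card_le_relP; exists (fun p z => A p.1 /\ A p.2 /\ z = m (h p.1) (h p.2)).
  split=> [[x y] [/= Ax Ay]|[x y] [x' y'] z /= [Ax [Ay ->]] [Ax' [Ay']]].
    exists (m (h x) (h y)); last by [].
    by apply: MA; apply: mM; apply: hM; exact: inM.
  move: (inM _ Ax) (inM _ Ay) (inM _ Ax') (inM _ Ay') => {}Ax {}Ay {}Ax' {}Ay'.
  move=> /(m_inj _ _ _ _ (hM _ Ax) (hM _ Ay) (hM _ Ax') (hM _ Ay'))[ex ey].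
  by rewrite (h_inj _ _ Ax Ax' ex) (h_inj _ _ Ay Ay' ey).
(* Otherwise the complement contains a copy [Y] of the carrier, and the pairing extends to the union
   of both, against maximality. *)
move=> /card_le_relP[V [Vtot Vinj]].
have /choice[g gP] : forall x, exists y, dom M x -> (A `\` dom M) y /\ V x y.
  move=> x; have [xM|xM] := pselect (dom M x); last by exists x.
  by have [y yA Vxy] := Vtot _ xM; exists y.
have g_inj x y : dom M x -> dom M y -> g x = g y -> x = y.
  by move=> /gP[_ Vx] /gP[_ Vy] e; apply: (Vinj x y (g x)) => //; rewrite e.
pose Y := g @` dom M.
have [h [hM h_inj]] : exists h : T -> T,
    (forall x, dom M x \/ Y x -> dom M (h x)) /\
    (forall x y, dom M x \/ Y x -> dom M y \/ Y y -> h x = h y -> x = y).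
  by apply: code; exact: card_image_le.
have YA y : Y y -> A y /\ ~ dom M y by move=> [x /gP[+ _] <-].
(* New pairs are coded in the carrier through [h] and then moved into [Y] by [g], so their values
   never meet those of [M]. *)
pose N := [set w : T * T * T | exists x y, [/\ dom M x \/ Y x, dom M y \/ Y y,
  ~ (dom M x /\ dom M y) & w = (x, y, g (m (h x) (h y)))]].
have domN x : dom (M `|` N) x <-> dom M x \/ Y x.
  split=> [[z [Mz|[y [y' [yY y'Y nyy' [-> _ _]]]]]]|[[z Mz]|Yx]] //.
  - by left; exists z.
  - by exists z; left.
  exists (g (m (h x) (h x))); right; exists x, x; split=> //; try by right.
  by case: (YA _ Yx) => _ nx [].
have gN x y z : dom M z -> ~ M (x, y, g z).
  by move=> zM /Msub[_ _]; case: (gP _ zM) => -[].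
case: (Mmax (M `|` N)).
  split; first exact: subsetUl.
  move=> /(_ (g (i 0), g (i 0), g (m (h (g (i 0))) (h (g (i 0)))))) MN.
  have Y0 : Y (g (i 0)) by exists (i 0).
  apply: gN (MN _); first by apply: mM; apply: hM; right.
  right; exists (g (i 0)), (g (i 0)); split=> //; try by right.
  by case: (YA _ Y0) => _ n0 [].
split.
- move=> x y /domN xN /domN yN.
  have [[xM yM]|nxy] := pselect (dom M x /\ dom M y).
    by exists (m x y); left; exact: mP.
  by exists (g (m (h x) (h y))); right; exists x, y.
- move=> x y z [/Msub[xM yM zM]|[x' [y' [x'N y'N _ [-> -> ->]]]]].
    by split; apply/domN; left.
  split; apply/domN => //; right; exists (m (h x') (h y')) => //.
  by apply: mM; exact: hM.
- by move=> x /domN[/MA //|/YA[]].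
have hhM x y : dom M x \/ Y x -> dom M y \/ Y y -> dom M (m (h x) (h y)).
  by move=> xN yN; apply: mM; exact: hM.
move=> p q z [Mp [Mq|]|[x [y [xN yN _ [-> ->]]]] []].
- exact: Minj Mp Mq.
- move=> [x [y [xN yN _ [_ e]]]]; case: p Mp => p1 p2; rewrite e => /gN[].
  exact: hhM.
- by case: q => q1 q2 /gN[]; exact: hhM.
move=> [x' [y' [x'N y'N _ [-> /(g_inj _ _ (hhM _ _ xN yN) (hhM _ _ x'N y'N))]]]].
move=> /(m_inj _ _ _ _ (hM _ xN) (hM _ yN) (hM _ x'N) (hM _ y'N))[ex ey].
by rewrite (h_inj _ _ xN x'N ex) (h_inj _ _ yN y'N ey).
Qed.

(** Let [B] be the larger set. If it is infinite, two tagged copies of it fit into its square, hence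
    into [B]; if it is finite, so is the union. *)
Lemma card_lt_setU T V (A B : set T) (C : set V) : infinite_set C ->
  A #< C -> B #< C -> A `|` B #< C.
Proof.
move=> Cinf; wlog AB : A B / A #<= B => [th AC BC|].
  have [AB|BA] := card_le_total A B; first exact: th.
  by rewrite setUC; exact: th.
move=> [AC nAC] [BC nBC].
suff: A `|` B #<= B \/ finite_set (A `|` B).
  move=> [ABB|ABfin].
    split; first exact: card_le_trans ABB BC.
    by move=> CAB; apply: nBC; exact: card_le_trans CAB ABB.
  split; last by move=> /card_le_finite-/(_ ABfin).
  case: (card_le_total (A `|` B) C) => // CAB.
  by case: Cinf; exact: card_le_finite CAB ABfin.
have [Bfin|Binf] := pselect (finite_set B).
  by right; rewrite finite_setU; split=> //; exact: card_le_finite AB Bfin.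
left; apply: card_le_trans (card_setX_infinite Binf).
have [i [iB i01]] : exists i : bool -> T, (forall b, B (i b)) /\ i true <> i false.
  have /infiniteP/card_le_relP[W [Wtot Winj]] := Binf.
  have [x Bx Wx] := Wtot 0 I; have [y By Wy] := Wtot 1 I.
  exists (fun b => if b then x else y); split=> [[]//|/= xy].
  by have := Winj 0 1 x Wx; rewrite {1}xy => /(_ Wy).
have /card_le_relP[W [Wtot Winj]] := AB.
apply/card_le_relP; exists (fun x p => B x /\ p = (x, i true) \/
  ~ B x /\ W x p.1 /\ p.2 = i false).
split=> [x ABx|x y p].
  have [Bx|nBx] := pselect (B x).
    by exists (x, i true); [split; [|exact: iB]|left; split].
  have [y By Wxy] : exists2 y, B y & W x y by apply: Wtot; case: ABx.
  by exists (y, i false); [split; [|exact: iB]|right; split].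
move=> [[Bx ->]|[nBx [Wx px]]] [[By]|[nBy [Wy py]]] //=.
- by case.
- by move=> e; move: px; rewrite e => /= /i01.
- exact: Winj Wx Wy.
Qed.

Lemma card_lt_image T U V (f : T -> U) (A : set T) (C : set V) :
  A #< C -> f @` A #< C.
Proof.
move=> [leAC nleCA]; split; first exact: card_le_trans (card_image_le _ _) leAC.
by move=> /card_le_trans/(_ (card_image_le _ _)).
Qed.

Lemma card_lt_set1 T V (x : T) (C : set V) : infinite_set C -> [set x] #< C.
Proof.
move=> Cinf; split; last by move=> /card_le_finite Cx; apply/Cinf/Cx/finite_set1.
have [//|/card_le_finite Cx] := card_le_total [set x] C.
by case: Cinf; apply/Cx/finite_set1.
Qed.

(** A function is coded by the indicator of its graph, carried into [K] by an injection of the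
    square. *)
Lemma card_le_arrow_bool K : infinite_set [set: K] ->
  [set: K -> K] #<= [set: K -> bool].
Proof.
move=> /card_setX_infinite/card_le_relP[W [Wtot Winj]].
apply/card_le_relP; exists (fun f b => forall k, b k <-> exists x, W (x, f x) k).
split=> [f _|f g b fb gb].
  by exists (fun k => `[< exists x, W (x, f x) k >]) => // k; split=> /asboolP.
apply/funext => x; have [|k _ Wk] := Wtot (x, f x); first by split.
have /gb[y Wy] : b k by apply/fb; exists x.
by have [<-] := Winj _ _ _ Wk Wy.
Qed.

(** * Overgroups *)

Section ReducedPower.
Local Open Scope group_scope.
Local Open Scope quotient_scope.
Variables (I : Type) (G : groupType) (F : set_system I).
Hypothesis F_proper : ProperFilter F.

Definition eventually_eq (f g : I -> G) : bool := `[< F [set i | f i = g i] >].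

Lemma eventually_eqP f g : reflect (F [set i | f i = g i]) (eventually_eq f g).
Proof. exact: asboolP. Qed.

Lemma eventually_eq_refl : reflexive eventually_eq.
Proof. by move=> f; apply/eventually_eqP; apply: filterS filterT. Qed.

Lemma eventually_eq_sym : symmetric eventually_eq.
Proof.
by move=> f g; apply/eventually_eqP/eventually_eqP; apply: filterS => i /= ->.
Qed.

Lemma eventually_eq_trans : transitive eventually_eq.
Proof.
move=> g f h /eventually_eqP fg /eventually_eqP gh; apply/eventually_eqP.
by apply: filterS (filterI fg gh) => i [/= -> ->].
Qed.

Canonical eventually_eq_equiv := EquivRel eventually_eq
  eventually_eq_refl eventually_eq_sym eventually_eq_trans.

Definition reduced_power := {eq_quot eventually_eq_equiv}.
HB.instance Definition _ := Choice.on reduced_power.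

Definition rp_class (f : I -> G) : reduced_power := \pi f.

Lemma rp_classP f g : rp_class f = rp_class g <-> F [set i | f i = g i].
Proof.
split=> [/eqmodP /= /eventually_eqP //|fg].
by apply/eqmodP; apply/eventually_eqP.
Qed.

Lemma rp_classK x : rp_class (repr x) = x.
Proof. exact: reprK. Qed.

(** Computed on chosen representatives; [rp_mulE] shows that the choice does not matter. *)
Definition rp_mul (x y : reduced_power) := rp_class (fun i => repr x i * repr y i).
Definition rp_inv (x : reduced_power) := rp_class (fun i => (repr x i)^-1).

Lemma repr_class f : F [set i | repr (rp_class f) i = f i].
Proof. by apply/rp_classP; rewrite rp_classK. Qed.

Lemma rp_mulE f g : rp_mul (rp_class f) (rp_class g) = rp_class (fun i => f i * g i).
Proof.
apply/rp_classP; apply: filterS (filterI (repr_class f) (repr_class g)).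
by move=> i [/= -> ->].
Qed.

Lemma rp_invE f : rp_inv (rp_class f) = rp_class (fun i => (f i)^-1).
Proof. by apply/rp_classP; apply: filterS (repr_class f) => i /= ->. Qed.

Lemma rp_mulA : associative rp_mul.
Proof.
move=> x y z; rewrite -(rp_classK x) -(rp_classK y) -(rp_classK z) !rp_mulE.
by congr rp_class; apply/funext => i; rewrite mulgA.
Qed.

Lemma rp_mul1 : left_id (rp_class (fun=> 1)) rp_mul.
Proof.
move=> x; rewrite -(rp_classK x) !rp_mulE.
by congr rp_class; apply/funext => i; rewrite mul1g.
Qed.

Lemma rp_mul1r : right_id (rp_class (fun=> 1)) rp_mul.
Proof.
move=> x; rewrite -(rp_classK x) !rp_mulE.
by congr rp_class; apply/funext => i; rewrite mulg1.
Qed.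

Lemma rp_mulV : left_inverse (rp_class (fun=> 1)) rp_inv rp_mul.
Proof.
move=> x; rewrite -(rp_classK x) rp_invE !rp_mulE.
by congr rp_class; apply/funext => i; rewrite mulVg.
Qed.

Lemma rp_mulVr : right_inverse (rp_class (fun=> 1)) rp_inv rp_mul.
Proof.
move=> x; rewrite -(rp_classK x) rp_invE !rp_mulE.
by congr rp_class; apply/funext => i; rewrite mulgV.
Qed.

HB.instance Definition _ :=
  isGroup.Build reduced_power rp_mulA rp_mul1 rp_mul1r rp_mulV rp_mulVr.

Lemma rp_classM f g :
  rp_class f * rp_class g = rp_class (fun i => f i * g i) :> reduced_power.
Proof. exact: rp_mulE. Qed.

Lemma rp_classV f : (rp_class f)^-1 = rp_class (fun i => (f i)^-1) :> reduced_power.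
Proof. exact: rp_invE. Qed.

Lemma rp_classJ f g :
  rp_class f ^ rp_class g = rp_class (fun i => f i ^ g i) :> reduced_power.
Proof. by rewrite conjgE rp_classV (rp_classM f g) rp_classM. Qed.

Definition rp_diag (g : G) : reduced_power := rp_class (fun=> g).

Lemma rp_diagM : {morph rp_diag : x y / x * y}.
Proof. by move=> x y; rewrite /rp_diag rp_classM. Qed.

HB.instance Definition _ := isMultiplicative.Build G reduced_power rp_diag rp_diagM.

(** Members of a proper filter are nonempty, so constants that agree on one of them are equal. The
    reduced power is thus an overgroup of [G]. *)
Lemma rp_diag_inj : injective rp_diag.
Proof.
move=> x y /rp_classP xy; apply: contrapT => nxy.
by apply: (@filter_not_empty _ F); apply: filterS xy => i.
Qed.

End ReducedPower.

(** * Systems solved by existential closedness *)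

Section Solving.
Local Open Scope group_scope.
Variables (K : Type) (G : groupType).
Hypothesis Gec : existentially_closed K G.

(** The class of [w] in the reduced power solves all the equations at once. *)
Lemma ec_conjugator (I : Type) (F : set_system I) (w : I -> G) (P : set (G * G)) :
    ProperFilter F -> P #< [set: K] ->
    (forall p, P p -> F [set i | p.1 ^ w i = p.2]) ->
  exists x, forall p, P p -> p.1 ^ x = p.2.
Proof.
move=> FF PK Fw.
pose lit (p : G * G) := Equation
  (Mul (Defs.Inv (Var G tt)) (Mul (Coef unit p.1) (Var G tt))) (Coef unit p.2).
have [||v vP] := Gec (S := lit @` P).
- exact: card_lt_image.
- exists (reduced_power G FF), (@rp_diag I G F FF); split; first exact: rp_diag_inj.
  exists (fun=> rp_class FF w) => _ [p Pp <-] /=.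
  by rewrite -conjgE rp_classJ; apply/rp_classP; exact: Fw.
by exists (v tt) => p Pp; apply: (vP (lit p)); exists p.
Qed.

(** In the product of [G] with the symmetric group on the three points of [option bool], the second
    factor centralizes [G] and is not abelian. *)
Lemma ec_noncentral_centralizer (A : set G) : infinite_set [set: K] ->
  A #< [set: K] -> exists c y, (forall a, A a -> a ^ c = a) /\ y ^ c <> y.
Proof.
move=> Kinf AK.
pose c := Var G true; pose y := Var G false.
pose lit (a : G) := Equation (Mul (Coef bool a) c) (Mul c (Coef bool a)).
pose S := lit @` A `|` [set Inequation (Mul y c) (Mul c y)].
have [||v vP] := Gec (S := S).
- by apply: card_lt_setU => //; [exact: card_lt_image|exact: card_lt_set1].
- exists (G * {perm option bool})%type.
  have diagM : {morph (fun g : G => (g, 1) : G * {perm option bool}) : a b / a * b}.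
    by move=> a b; congr pair; rewrite mulg1.
  pose i := HB.pack_for {multiplicative G -> G * {perm option bool}}
    (fun g : G => (g, 1) : G * {perm option bool})
    (isMultiplicative.Build _ _ _ diagM).
  exists i; split; first by move=> a b [].
  (* Transpositions sharing the point [None]: their two products send [None] to different points. *)
  pose s : {perm option bool} := tperm None (Some true).
  pose t : {perm option bool} := tperm None (Some false).
  exists (fun b => (1, if b then s else t)).
  move=> l [[a Aa <-]|->] /=.
    by congr pair; rewrite ?mulg1 ?mul1g.
  move=> [] /(congr1 (fun p : {perm option bool} => p None)).
  by rewrite !permM /s /t !tpermL !tpermD.
exists (v true), (v false); split=> [a Aa|vv].
  have /= ac : literal_holds idfun v (lit a) by apply: vP; left; exists a.
  by rewrite conjgE ac mulKg.
have /= : literal_holds idfun v (Inequation (Mul y c) (Mul c y)).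
  by apply: vP; right.
by apply; rewrite conjgC vv.
Qed.
End Solving.

(** * Well-orders *)

Section WellOrder.
Variables (K : Type) (R : rel K).
Hypothesis R_wo : well_order R.

Definition below (k : K) : set K := [set j | R j k /\ j <> k].

Lemma wo_min (P : set K) : P !=set0 -> exists2 m, P m & forall x, P x -> R m x.
Proof.
move=> [x Px]; have [|m [[mP mmin] _]] := R_wo (A := fun x => `[< P x >]).
  by exists x; apply/asboolP.
exists m => [|y Py]; first by move: mP => /asboolP.
by apply: mmin; apply/asboolP.
Qed.

Lemma wo_refl x : R x x.
Proof. by have [|m -> /(_ x)->] := wo_min (P := [set x]); first by exists x. Qed.

(** Both are minima of the pair, and [well_order] makes minima unique. *)
Lemma wo_anti x y : R x y -> R y x -> x = y.
Proof.
move=> xy yx; have [|m [_ mU]] := R_wo (A := fun z => `[< z = x \/ z = y >]).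
  by exists x; apply/asboolP; left.
rewrite -(mU x) ?(mU y) //; split; try by apply/asboolP; auto.
  by move=> z /asboolP[]->; [|exact: wo_refl].
by move=> z /asboolP[]->; [exact: wo_refl|].
Qed.

(** Whichever of the three points is the minimum of their set, antisymmetry reduces the claim to
    minimality. *)
Lemma wo_trans y x z : R x y -> R y z -> R x z.
Proof.
move=> xy yz.
have [|m] := wo_min (P := [set w | [\/ w = x, w = y | w = z]]).
  by exists x; constructor 1.
move=> [->|->|->] mmin; first by apply: mmin; constructor 3.
  by rewrite (wo_anti xy) //; apply: mmin; constructor 1.
by rewrite -(wo_anti yz) //; apply: mmin; constructor 2.
Qed.

Lemma wo_trichotomy x y : [\/ below y x, x = y | below x y].
Proof.
have [->|xy] := pselect (x = y); first by constructor 2.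
have [|m] := wo_min (P := [set w | w = x \/ w = y]); first by exists x; left.
move=> [->|->] mmin; first by constructor 1; split=> //; apply: mmin; right.
by constructor 3; split; [apply: mmin; left|exact: nesym].
Qed.

Lemma below_trans y x z : below y x -> below z y -> below z x.
Proof.
move=> [xy nxy] [yz nyz]; split; first exact: wo_trans xy yz.
by move=> xz; apply: nyz; apply: wo_anti => //; rewrite -xz.
Qed.

Lemma below_wf : well_founded (fun j k => below k j).
Proof.
move=> x; apply: contrapT => nx.
have [|m nm mmin] := wo_min (P := [set x | ~ Acc (fun j k => below k j) x]).
  by exists x.
apply: nm; constructor => y [ym nym]; apply: contrapT => ny.
by apply: nym; apply: wo_anti => //; exact: mmin.
Qed.

(** The default [x0] makes the history a total function, so [step] needs no dependent argument. *)
Lemma wo_recursion (T : Type) (x0 : T) (step : K -> (K -> T) -> T) :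
  exists t : K -> T,
    forall k, t k = step k (fun j => if `[< below k j >] then t j else x0).
Proof.
pose F k (rec : forall j, below k j -> T) :=
  step k (fun j => if pselect (below k j) is left jk then rec j jk else x0).
exists (Fix below_wf (fun=> T) F) => k; rewrite Fix_eq => [|j f g fg].
  congr step; apply/funext => j.
  by case: pselect => [jk|njk]; case: asboolP.
by congr step; apply/funext => i; case: pselect.
Qed.

End WellOrder.

(** * The tree of conjugators *)

Section Tree.
Local Open Scope group_scope.
Variables (K : Type) (G : groupType) (R : rel K) (e : K -> G).
Hypotheses (R_init : initial_order R) (Kinf : infinite_set [set: K]).
Hypothesis Gec : existentially_closed K G.

Let R_wo : well_order R := R_init.1.

(* Stage [j], with conjugator [u.1] and splitting witness [u.2], fixes the values
   of the automorphism on these elements; the second one is the preimage of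
   [e j]. *)
Definition stage (j : K) (u : G * G) : set G :=
  [set a | [\/ a = e j, a = e j ^ u.1^-1 | a = u.2]].

Definition coherent (u : K -> G * G) (k : K) : Prop :=
  forall i a, below R k i -> stage i (u i) a -> a ^ (u k).1 = a ^ (u i).1.

(** With [r] read as ((x, c), y), both x and c x respect the earlier stages, because c fixes their
    elements; they differ at y, because c moves it. *)
Lemma extend_stages (u : K -> G * G) k :
    (forall j, below R k j -> coherent u j) ->
  exists r : (G * G) * G,
    (forall j a, below R k j -> stage j (u j) a ->
       a ^ r.1.1 = a ^ (u j).1 /\ a ^ r.1.2 = a) /\ r.2 ^ r.1.2 <> r.2.
Proof.
move=> ucoh; set B := below R k.
pose f (g : K -> G) j := (g j, g j ^ (u j).1).
(* The prescribed values, one image of [B] for each kind of element in a stage; [B] is smaller than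
   [K] because the order is initial. *)
pose P := f e @` B `|` f (fun j => e j ^ (u j).1^-1) @` B
  `|` f (fun j => (u j).2) @` B.
have BK : B #< [set: K] by exact: R_init.2.
have PK : P #< [set: K] by do !apply: card_lt_setU => //; exact: card_lt_image.
have inP j a : B j -> stage j (u j) a -> P (a, a ^ (u j).1).
  by move=> Bj [->|->|->]; [left; left|left; right|right]; exists j.
have Pin p : P p -> exists j, [/\ B j, stage j (u j) p.1 & p.2 = p.1 ^ (u j).1].
  move=> [[]|] [j Bj <-]; exists j; split=> //=.
  - by constructor 1.
  - by constructor 2.
  - by constructor 3.
have [c [y [cP cy]]] := ec_noncentral_centralizer Gec Kinf (card_lt_image fst PK).
have [x xP] : exists x, forall p, P p -> p.1 ^ x = p.2.
  (* At the least [k] there are no constraints, and the final segments would not form a proper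
     filter. *)
  have [[j0 Bj0]|/nonemptyPn B0] := pselect (B !=set0); last first.
    by exists 1 => p /Pin[j []]; rewrite B0.
  pose F : set_system K :=
    [set Q | exists2 i, B i & forall j, B j -> R i j -> Q j].
  apply: (ec_conjugator Gec (F := F) (w := fun j => (u j).1)) PK _ => [|p].
    split=> [[i Bi]|]; first by move=> /(_ i Bi (wo_refl R_wo i)).
    split=> [|Q Q' [i Bi Qi] [i' Bi' Qi']|Q Q' QQ' [i Bi Qi]].
    - by exists j0.
    - wlog ii' : Q Q' i i' Bi Qi Bi' Qi' / R i i' => [th|].
        have [[ii' _]|ii'|[i'i _]] := wo_trichotomy R_wo i i'.
        + exact: (th Q Q' i i').
        + by apply: (th Q Q' i i') => //; rewrite ii'; exact: wo_refl.
        + by rewrite setIC; exact: (th Q' Q i' i).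
      exists i' => // j Bj i'j; split; last exact: Qi'.
      by apply: Qi => //; exact: wo_trans ii' i'j.
    - by exists i => // j Bj ij; apply: QQ'; exact: Qi.
  (* By coherence, a value prescribed at stage [i] is respected from [i] on. *)
  move=> /Pin[i [Bi ia ->]]; exists i => // j Bj ij /=.
  have [->//|nij] := pselect (i = j).
  by apply: ucoh => //; split.
exists ((x, c), y); split=> //= j a Bj ja; split; first exact: xP (inP _ _ Bj ja).
by apply: cP; exists (a, a ^ (u j).1) => //; exact: inP.
Qed.

Lemma stage_tree :
  exists u : (K -> bool) -> K -> G * G,
    (forall b k, coherent (u b) k) /\
    (forall b b' k, b k <> b' k -> (forall j, below R k j -> b j = b' j) ->
       (u b k).2 = (u b' k).2 /\ (u b k).2 ^ (u b k).1 <> (u b k).2 ^ (u b' k).1).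
Proof.
(* The choice is made before any branch is fixed and depends only on the history, so branches that
   agree below [k] receive the same triple at [k]. *)
have /choice[sol solP] : forall ku : K * (K -> G * G), exists r : (G * G) * G,
    (forall j, below R ku.1 j -> coherent ku.2 j) ->
    (forall j a, below R ku.1 j -> stage j (ku.2 j) a ->
       a ^ r.1.1 = a ^ (ku.2 j).1 /\ a ^ r.1.2 = a) /\ r.2 ^ r.1.2 <> r.2.
  move=> [k u] /=; have [/extend_stages[r rP]|nu] :=
    pselect (forall j, below R k j -> coherent u j); first by exists r.
  by exists ((1, 1), 1).
pose step (b : K -> bool) k u :=
  let: ((x, c), y) := sol (k, u) in (if b k then c * x else x, y).
have /choice[u uE] b := wo_recursion R_wo (1, 1) (step b).
(* The truncated history that the recursion passes to [step]. *)
pose v b k j := if `[< below R k j >] then u b j else (1, 1).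
have vE b k j : below R k j -> v b k j = u b j by rewrite /v => /asboolP->.
have vcoh b k : (forall j, below R k j -> coherent (u b) j) ->
    forall j, below R k j -> coherent (v b k) j.
  move=> ucoh j jk i a ij.
  have ik := below_trans R_wo ij jk.
  by rewrite !vE //; exact: ucoh.
have ucoh b k : coherent (u b) k.
  elim/(well_founded_ind (below_wf R_wo)): k => k /vcoh/(solP (k, v b k))[].
  move=> sP _ i a ik ia.
  have [|] := sP i a ik; rewrite /= vE // => ax ac.
  rewrite uE /step -/(v b k); case: (sol _) ax ac => -[x c] y /= ax ac.
  by case: ifP => _; rewrite ?conjgM ?ac ax.
exists u; split=> // b b' k bb' bb'_below.
have uu' j : below R k j -> u b j = u b' j.
  elim/(well_founded_ind (below_wf R_wo)): j => j IH jk.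
  rewrite !uE /step -/(v b j) -/(v b' j) bb'_below //.
  suff -> : v b j = v b' j by [].
  apply/funext => i; rewrite /v; case: asboolP => // ij; apply: IH => //.
  exact: below_trans ij jk.
have vv' : v b k = v b' k.
  by apply/funext => i; rewrite /v; case: asboolP => // /uu'.
have [_] := solP (k, v b k) (vcoh b k (fun j _ => ucoh b j)).
rewrite !uE -/(v b k) -/(v b' k) -vv' /step; case: (sol _) => -[x c] y /= yc.
(* Cancelling the conjugation by x in y ^ (c x) = y ^ x would give y ^ c = y. *)
split=> //; case: (b k) (b' k) bb' => [] [] //= _.
  by rewrite conjgM => /conjg_inj.
by rewrite conjgM => /esym/conjg_inj.
Qed.

End Tree.

(** * Counting the automorphisms of [G] *)

Theorem theorem1p1 (K : Type) (G : groupType) :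
  regular_cardinal K ->
  existentially_closed K G ->
  [set: G] #= [set: K] ->
  Aut G #= [set: K -> bool].
Proof.
move=> [Kinf [R R_init _]] Gec GK.
have R_wo := R_init.1.
have [e [d de ed]] : exists e : K -> G, bijective e.
  have /card_bijP[f [g fg gf]] := GK.
  exists (fun k => val (g (SigSub (mem_set (I : [set: K] k))))).
  exists (fun a => val (f (SigSub (mem_set (I : [set: G] a))))) => x.
    set y := g _; have -> : SigSub (mem_set (I : [set: G] (val y))) = y.
      exact: val_inj.
    by rewrite /y gf.
  set y := f _; have -> : SigSub (mem_set (I : [set: K] (val y))) = y.
    exact: val_inj.
  by rewrite /y fg.
rewrite card_eq_le; apply/andP; split.
  apply: card_le_trans (card_le_arrow_bool Kinf).
  apply/card_le_relP; exists (fun f h => forall k, h k = d (f (e k))).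
  split=> [f _|f g h fh gh]; first by exists (fun k => d (f (e k))).
  apply/funext => a; apply: (can_inj ed).
  by have := fh (d a); rewrite gh ed.
have [u [ucoh usplit]] := stage_tree e R_init Kinf Gec.
(* The limit along the branch [b]: the image of [a] is settled at stage [d a], where [a] is
   enumerated. *)
pose phi b a := (a ^ (u b (d a)).1)%g.
have phiE b k i a : R i k -> stage e i (u b i) a -> phi b a = (a ^ (u b k).1)%g.
  move=> ik ia; have stage_d j : e j = a -> stage e j (u b j) a.
    by move=> <-; constructor 1.
  have coh j l x : R j l -> stage e j (u b j) x ->
      (x ^ (u b l).1 = x ^ (u b j).1)%g.
    move=> jl jx; have [->//|njl] := pselect (j = l).
    by apply: ucoh => //; split.
  rewrite (coh i k a) // /phi.
  have [[di _]|->//|[id _]] := wo_trichotomy R_wo (d a) i.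
    by rewrite (coh (d a) i a) //; apply: stage_d.
  exact: coh.
have phi_d b k a : R (d a) k -> phi b a = (a ^ (u b k).1)%g.
  by move=> ak; apply: phiE ak _; constructor 1; rewrite ed.
(* Any finitely many elements are handled by one late conjugator, so [phi b] inherits
   multiplicativity and injectivity from conjugations. *)
have max2 x y : exists k, R x k /\ R y k.
  have [[xy _]|->|[yx _]] := wo_trichotomy R_wo x y.
  - by exists y; split=> //; exact: wo_refl.
  - by exists y; split; exact: wo_refl.
  - by exists x; split=> //; exact: wo_refl.
have phi_aut b : Aut G (phi b).
  split=> [x y|].
    have [k [xk yk]] := max2 (d x) (d y); have [l [kl xyl]] := max2 k (d (x * y)%g).
    rewrite !(phi_d _ l) ?conjMg //; exact: wo_trans kl.
  have phi_inj : injective (phi b).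
    move=> x y; have [k [xk yk]] := max2 (d x) (d y).
    by rewrite !(phi_d _ k) // => /conjg_inj.
  have phi_surj a : exists x, phi b x = a.
    (* Stage [d a] also fixes the value on this preimage. *)
    exists (a ^ (u b (d a)).1^-1)%g.
    rewrite (phiE b (d a) (d a)) ?conjgKV ?(wo_refl R_wo) //.
    by constructor 2; rewrite ed.
  have /choice[psi psiP] := phi_surj.
  by exists psi => // x; apply: phi_inj.
apply/card_le_relP; exists (fun b f => f = phi b); split=> [b _|b b' f -> bb'].
  by exists (phi b).
apply: contrapT => nbb'.
(* At the first difference the branches share the witness [y], and their automorphisms separate
   it. *)
have [|k bk kmin] := wo_min R_wo (P := [set k | b k <> b' k]).
  apply: contrapT => /nonemptyPn b0; apply: nbb'; apply/funext => k.
  by apply: contrapT => bk; have : [set k | b k <> b' k] k by []; rewrite b0.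
have [|y2 []] := usplit b b' k bk.
  move=> j [jk njk]; apply: contrapT => bj; apply: njk.
  by apply: wo_anti jk (kmin _ bj).
set y := (u b k).2 in y2 *.
rewrite -(phiE b k k y) ?(wo_refl R_wo) //; last by constructor 3.
by rewrite -(phiE b' k k y) ?(wo_refl R_wo) ?bb' //; constructor 3.
Qed.
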